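(* Let $\mathcal{C}_{N,1}$ be the set of all $3$-path components that occur in minimal cluster elements of $\Omega_3^{N,1}$: $$\mathcal{C}_{N,1}=\Big\{v\in\mathcal{A}_3\ \Big|\ \exists\text{ a minimal cluster } w\in\Omega_3^{N,1}\text{ such that } w=\alpha_v v+\sum_i\alpha_{v_i}v_i,\ v_i\in\mathcal{A}_3\Big\}.$$ Let $\phi:\mathcal{C}_{N,1}\to\{T,S,W,N_w\}^4$ be the image-type map. Then, for $N\ge 2$, $$\phi(\mathcal{C}_{N,1})=\{(T,T,T,T),(T,S,S,T)\}\cup\mathcal{L},$$ where $\mathcal{L}$ consists of exactly seven patterns, namely $$(S,T,N_w,T),\ (S,S,N_w,T),\ (S,W,N_w,T),\ (T,N_w,T,S),\ (T,N_w,S,S),\ (T,N_w,W,S),\ (S,N_w,N_w,S).$$ In particular, $|\phi(\mathcal{C}_{N,1})|=9$.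
   Context: All spaces are those of the path complex of a simple digraph $G=(V,E)$ (finite vertex set, no multiple edges, no loops). Let $\xi\in\mathbb{C}$ be a primitive $N$-th root of unity. An elementary $p$-path is a sequence of $p+1$ vertices, written $e_{i_0,\dots,i_p}$; it is regular if consecutive vertices differ, and allowed if each $(i_k,i_{k+1})$ is an edge of $G$. $\mathcal{A}_n$ is the $\mathbb{C}$-span of the allowed elementary $n$-paths. The (regular) boundary operator is $\partial(e_{i_0,\dots,i_p})=\sum_{j=0}^p\xi^j e_{i_0,\dots,\widehat{i_j},\dots,i_p}$, with irregular paths on the right set to $0$. $\Omega_3^{N,1}=\{v\in\mathcal{A}_3\mid\partial v\in\mathcal{A}_2\}$. An $(a,b)$-cluster is a path all of whose elementary paths with nonzero coefficient (its components) start at $a$ and end at $b$; a cluster is an $(a,b)$-cluster for some vertices $a,b$. An element of $\Omega_3^{N,1}$ is minimal if no sub linear combination of its components is in $\Omega_3^{N,1}$. For $v=e_{i,j,k,l}\in\mathcal{A}_3$ the image-type is $\phi(v)=(\phi(e_{j,k,l}),\phi(e_{i,k,l}),\phi(e_{i,j,l}),\phi(e_{i,j,k}))$, where each entry records the type of the corresponding $2$-path: $T$ = triangle, $S$ = square, $W$ = admissible, $N_w$ = non-admissible. Here $e_{x,y,z}$ is non-admissible if it is not allowed; an allowed $e_{x,y,z}$ is of triangle type if $(x,z)$ is an edge, of square type if $(x,z)$ is not an edge and there is another allowed $2$-path $e_{x,y',z}$ with $y'\ne y$, and of type $W$ (only admissible) if $(x,z)$ is not an edge and there is no other allowed $2$-path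 from $x$ to $z$.
   Formalization: ''No multiple edges'' is taken to exclude pairs of opposite edges x→y, y→x (otherwise e_{i,j,i,l} with edges ij, ji, il, jl gives the extra pattern (T,N_w,T,W)), and the set of components is taken over all finite simple digraphs. *)

(* Defs.v *)
From mathcomp Require Import all_boot all_order all_algebra.
From mathcomp Require Import boolp classical_sets functions cardinality reals.
From mathcomp Require Import complex.

Set Implicit Arguments.
Unset Strict Implicit.
Unset Printing Implicit Defensive.

Import GRing.Theory.
Local Open Scope classical_set_scope.
Local Open Scope ring_scope.

(* [no_multi] is not automatic for a relation: at most one edge joins two     *)
(* vertices, so a pair of opposite edges x -> y, y -> x counts as multiple.   *)
Record simpleDigraph := SimpleDigraph {
  vertex : finType;
  edge : rel vertex;
  no_loop : forall x, ~~ edge x x;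
  no_multi : forall x y, ~~ (edge x y && edge y x)
}.

(* An elementary n-path has n + 1 vertices. *)
Notation epath G n := (n.+1.-tuple (vertex G)).

Section Paths.
Variables (K : fieldType) (G : simpleDigraph).

Definition regular n (p : epath G n) : bool := sorted (fun x y => x != y) p.

Definition allowed n (p : epath G n) : bool := sorted (@edge G) p.

Definition face n (j : 'I_n.+2) (p : epath G n.+1) : epath G n :=
  [tuple tnth p (lift j k) | k < n.+1].

(* Formal K-linear combinations of elementary n-paths, given by their         *)
(* coefficients.                                                              *)
Local Notation chain n := {ffun epath G n -> K^o}.

Definition elem n (p : epath G n) : chain n := [ffun q => (q == p)%:R].

Definition allowed_space n : {vspace chain n} :=
  <<[seq elem p | p <- enum (@allowed n)]>>%VS.

Definition boundary_elem (xi : K) n (p : epath G n.+1) : chain n :=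
  \sum_(j < n.+2 | regular (face j p)) xi ^+ j *: elem (face j p).

Definition boundary (xi : K) n (v : chain n.+1) : chain n :=
  \sum_(p : epath G n.+1) v p *: boundary_elem xi p.

(* For v : chain n.+1, membership in Omega_(n+1)^(N,1), where N is the order  *)
(* of the root of unity xi.                                                   *)
Definition Omega (xi : K) n (v : chain n.+1) : bool :=
  (v \in allowed_space n.+1) && (boundary xi v \in allowed_space n).

Definition components n (v : chain n) : {set epath G n} :=
  [set p | v p != 0]%SET.

Definition cluster n (v : chain n) : Prop :=
  exists a b : vertex G, forall p, p \in components v ->
    tnth p ord0 = a /\ tnth p ord_max = b.

(* A sub linear combination of the components of v is a nonzero linear        *)
(* combination, with arbitrary coefficients, of a proper subset of them.      *)
Definition minimal (xi : K) n (v : chain n.+1) : Prop :=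
  Omega xi v /\
  ~ exists u : chain n.+1,
      [/\ u != 0, components u \proper components v & Omega xi u].

Definition cluster_components (xi : K) : set (epath G 3) :=
  [set p | exists w : chain 3,
     [/\ minimal xi w, cluster w & p \in components w]].

End Paths.

Inductive path_type := T | S | W | N_w.

Definition type_of_path (G : simpleDigraph) (x y z : vertex G) : path_type :=
  if ~~ allowed [tuple x; y; z] then N_w
  else if edge x z then T
  else if [exists y', (y' != y) && allowed [tuple x; y'; z]] then S
  else W.

Definition pattern : Type := path_type * path_type * path_type * path_type.

Definition image_type (G : simpleDigraph) (p : epath G 3) : pattern :=
  let i := tnth p 0 in let j := tnth p 1 in
  let k := tnth p 2 in let l := tnth p 3 in
  (type_of_path j k l, type_of_path i k l,
   type_of_path i j l, type_of_path i j k).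

(* The paths are taken over all finite simple digraphs: a single digraph need *)
(* not exhibit every pattern.                                                 *)
Definition image_types (K : fieldType) (xi : K) : set pattern :=
  [set t | exists (G : simpleDigraph) (p : epath G 3),
     cluster_components xi p /\ image_type p = t].

Definition family_L : set pattern :=
  [set (S, T, N_w, T); (S, S, N_w, T); (S, W, N_w, T);
       (T, N_w, T, S); (T, N_w, S, S); (T, N_w, W, S);
       (S, N_w, N_w, S)].

(* Main.v *)
(* Since opposite edges are excluded, only the inner faces e_{i,k,l} and      *)
(* e_{i,j,l} of an allowed path e_{i,j,k,l} can fail to be allowed. So a      *)
(* chain of coefficients a_{i,j,k,l} lies in Omega exactly when the sum over  *)
(* j of a_{i,j,k,l} vanishes unless i -> k is an edge, and the sum over k     *)
(* vanishes unless j -> l is an edge. If i -> k is not an edge, some other    *)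
(* path e_{i,j',k,l} must therefore occur, so that e_{i,j,k} is a square;     *)
(* dually for j -> l. This leaves only the nine patterns. Conversely, between *)
(* fixed endpoints the components of a chain are the edges j -> k of a        *)
(* bipartite graph, with coefficients cancelling at every vertex but the k    *)
(* with i -> k and the j with j -> l, which are free. An edge joining two     *)
(* free vertices, and a 4-cycle with at most one free vertex, are minimal;    *)
(* they realise all the patterns.                                             *)

Require Import Defs.
From mathcomp Require Import all_boot all_order all_algebra.
From mathcomp Require Import boolp classical_sets functions cardinality reals.
From mathcomp Require Import complex.

Local Open Scope classical_set_scope.
Local Open Scope card_scope.
Local Open Scope ring_scope.
Local Open Scope complex_scope.

Import GRing.Theory.

(** The argument runs over any field and any nonzero [xi]. By [Omega3P], belonging to Omega means
    that certain sums of coefficients over a single middle vertex vanish. A nonzero term of a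
    vanishing sum has a companion, which is the second route that makes a face a square;
    [Omega_image_type] draws the nine patterns from this. In the other direction, [minimal_of_scale]
    reduces minimality to a one-dimensional solution space, which [triangle_component] obtains for a
    single path and [cycle_component] for a 4-cycle. Small variants of one seven-vertex digraph then
    show every pattern. *)

Section Omega3.
Set Implicit Arguments.
Unset Strict Implicit.
Unset Printing Implicit Defensive.

Context {K : fieldType} {G : simpleDigraph}.

Local Notation V := (vertex G).
Local Notation chain n := {ffun epath G n -> K^o}.

(** * Chains, faces and the boundary in coordinates *)

Lemma edge_neq {x y : V} : edge x y -> x != y.
Proof. by apply: contraTneq => ->; apply: no_loop. Qed.

Lemma edge_asym {x y : V} : edge x y -> ~~ edge y x.
Proof. by move=> xy; have := @no_multi G x y; rewrite xy. Qed.

Lemma tuple3E (p : epath G 2) :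
  p = [tuple tnth p 0; tnth p 1; tnth p 2].
Proof. by apply: eq_from_tnth; case=> [[|[|[|]]]] // ?; apply: tnth_nth. Qed.

Lemma tuple4E (p : epath G 3) :
  p = [tuple tnth p 0; tnth p 1; tnth p 2; tnth p 3].
Proof. by apply: eq_from_tnth; case=> [[|[|[|[|]]]]] // ?; apply: tnth_nth. Qed.

Lemma in_allowed_space n (v : chain n) :
  reflect (forall p, v p != 0 -> allowed p) (v \in allowed_space K G n).
Proof.
apply: (iffP idP) => [v_in p|v_supp].
  apply: contraNT => p_nallowed; move: v_in; rewrite /allowed_space.
  set X := map _ _ => v_in.
  rewrite (coord_span (X := in_tuple X) v_in) sum_ffunE big1 // => i _.
  rewrite ffunE; have : X`_i \in X by apply: mem_nth.
  case/mapP => q; rewrite mem_enum => q_allowed ->.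
  rewrite ffunE (_ : p == q = false) ?scaler0 //.
  by apply: contraNF p_nallowed => /eqP ->.
have -> : v = \sum_p v p *: elem K p.
  apply/ffunP => q; rewrite sum_ffunE (bigD1 q) //= !ffunE eqxx.
  rewrite [_ *: _]mulr1 big1 ?addr0 // => p p_q.
  by rewrite !ffunE eq_sym (negPf p_q) scaler0.
apply: memv_suml => p _; have [->|/v_supp p_allowed] := eqVneq (v p) 0.
  by rewrite scale0r mem0v.
by apply/memvZ/memv_span/map_f; rewrite mem_enum.
Qed.

Lemma faceE (x y z t : V) :
  [/\ face (0 : 'I_4) [tuple x; y; z; t] = [tuple y; z; t],
      face (1 : 'I_4) [tuple x; y; z; t] = [tuple x; z; t],
      face (2 : 'I_4) [tuple x; y; z; t] = [tuple x; y; t] &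
      face (3 : 'I_4) [tuple x; y; z; t] = [tuple x; y; z]].
Proof.
by split; apply: eq_from_tnth; case=> [[|[|[|]]]] // ?; rewrite tnth_mktuple !(tnth_nth x).
Qed.

(** Here [ins] inserts a vertex into [q] at position [j]; reading off that vertex is the inverse
    bijection. *)
Lemma sum_face (f : epath G 3 -> K) (j : 'I_4) (q : epath G 2)
    (ins : V -> epath G 3) :
    (forall y, face j (ins y) = q) -> (forall y, tnth (ins y) j = y) ->
    (forall a b c d, face j [tuple a; b; c; d] = q ->
      ins (tnth [tuple a; b; c; d] j) = [tuple a; b; c; d]) ->
  \sum_(p | face j p == q) f p = \sum_y f (ins y).
Proof.
move=> face_ins tnth_ins insK.
rewrite (reindex_onto ins (fun p => tnth p j)) => [|p /eqP].
  by apply: eq_bigl => y; rewrite face_ins tnth_ins !eqxx.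
by rewrite (tuple4E p); apply: insK.
Qed.

Lemma boundaryE (xi : K) (v : chain 3) (x y z : V) :
    regular [tuple x; y; z] ->
  boundary xi v [tuple x; y; z] =
    \sum_t v [tuple t; x; y; z] + xi * \sum_t v [tuple x; t; y; z]
    + xi ^+ 2 * \sum_t v [tuple x; y; t; z]
    + xi ^+ 3 * \sum_t v [tuple x; y; z; t].
Proof.
move=> xyz_reg; set q := [tuple x; y; z].
have -> : boundary xi v q =
    \sum_(j < 4) xi ^+ j * \sum_(p | face j p == q) v p.
  rewrite /boundary sum_ffunE.
  under [RHS]eq_bigr do rewrite big_distrr big_mkcond /=.
  rewrite exchange_big; apply: eq_bigr => p _.
  rewrite ffunE sum_ffunE big_mkcond scaler_sumr; apply: eq_bigr => j _.
  rewrite [_ == q]eq_sym; case: eqVneq => [q_face|q_face].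
    by rewrite -q_face xyz_reg !ffunE eqxx [_ *: 1]mulr1 [LHS]mulrC.
  by case: ifP => _; rewrite ?scaler0 // !ffunE (negPf q_face) !scaler0.
have [l1 l2 l3] : [/\ lift ord0 ord0 = 1 :> 'I_4,
    lift ord0 (lift ord0 ord0) = 2 :> 'I_4 &
    lift ord0 (lift ord0 (lift ord0 ord0)) = 3 :> 'I_4].
  by split; apply: val_inj.
rewrite !big_ord_recl big_ord0 addr0 !addrA l1 l2 l3 expr0 mul1r expr1.
congr (_ + _ * _ + _ * _ + _ * _); apply: sum_face => //.
- by move=> t; case: (faceE t x y z).
- by move=> a b c d; have [-> _ _ _] := faceE a b c d => /(congr1 val)[<- <- <-].
- by move=> t; case: (faceE x t y z).
- by move=> a b c d; have [_ -> _ _] := faceE a b c d => /(congr1 val)[<- <- <-].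
- by move=> t; case: (faceE x y t z).
- by move=> a b c d; have [_ _ -> _] := faceE a b c d => /(congr1 val)[<- <- <-].
- by move=> t; case: (faceE x y z t).
- by move=> a b c d; have [_ _ _ ->] := faceE a b c d => /(congr1 val)[<- <- <-].
Qed.

Lemma allowed4E (i j k l : V) :
  allowed [tuple i; j; k; l] = [&& edge i j, edge j k & edge k l].
Proof. by rewrite /allowed /= andbT. Qed.

Lemma allowed3E (i j k : V) : allowed [tuple i; j; k] = edge i j && edge j k.
Proof. by rewrite /allowed /= andbT. Qed.

Section AllowedChain.
Context {v : chain 3}.
Hypothesis v_allowed : forall p, v p != 0 -> allowed p.

Lemma coef_non_allowed (i j k l : V) :
  ~~ [&& edge i j, edge j k & edge k l] -> v [tuple i; j; k; l] = 0.
Proof. by rewrite -allowed4E; apply: contraNeq => /v_allowed. Qed.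

(** A vertex added at either end leaves x, y, z consecutive, so those extensions are not allowed;
    only inner insertions survive. *)
Lemma boundary_allowedE (xi : K) (x y z : V) :
    regular [tuple x; y; z] -> ~~ (edge x y && edge y z) ->
  boundary xi v [tuple x; y; z] =
    xi * \sum_t v [tuple x; t; y; z] + xi ^+ 2 * \sum_t v [tuple x; y; t; z].
Proof.
move=> xyz_reg nxyz; rewrite boundaryE //.
have -> : \sum_t v [tuple t; x; y; z] = 0.
  by apply: big1 => t _; rewrite coef_non_allowed // (negPf nxyz) andbF.
have -> : \sum_t v [tuple x; y; z; t] = 0.
  by apply: big1 => t _; rewrite coef_non_allowed // andbA (negPf nxyz).
by rewrite mulr0 addr0 add0r.
Qed.

End AllowedChain.

(** * The linear equations of the third Omega space *)

(* Only the two inner faces of an allowed 3-path can fail to be allowed, and  *)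
(* no 2-path is an inner face of both kinds; hence the powers of xi do not    *)
(* interact and drop out.                                                     *)
Lemma Omega3P (xi : K) (v : chain 3) : xi != 0 ->
  Omega xi v <->
  [/\ forall p, v p != 0 -> allowed p,
      forall i k l, edge k l -> ~~ edge i k -> \sum_j v [tuple i; j; k; l] = 0 &
      forall i j l, edge i j -> ~~ edge j l -> \sum_k v [tuple i; j; k; l] = 0].
Proof.
move=> xi_neq0.
split=> [/andP[/in_allowed_space v_allowed /in_allowed_space dv_allowed]
        |[v_allowed sumj sumk]].
  have v0 := coef_non_allowed v_allowed.
  have dv0 i j k : i != j -> j != k -> ~~ (edge i j && edge j k) ->
      xi * \sum_t v [tuple i; t; j; k] + xi ^+ 2 * \sum_t v [tuple i; j; t; k] = 0.
    move=> i_j j_k nijk; have ijk_reg : regular [tuple i; j; k].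
      by rewrite /regular /= i_j j_k.
    rewrite -(boundary_allowedE v_allowed) //; apply/eqP.
    by apply: contraNT nijk; rewrite -allowed3E => /dv_allowed.
  split=> // [i k l kl nik|i j l ij njl].
    (* For i = k the face is irregular and the boundary says nothing; the sum is zero because i -> j
       -> i would be a pair of opposite edges. *)
    have [<-|i_k] := eqVneq i k.
      rewrite big1 // => j _; apply: v0; apply/negP => /and3P[ij ji _].
      by have := edge_asym ji; rewrite ij.
    have := dv0 i k l i_k (edge_neq kl).
    rewrite (negPf nik) => /(_ isT).
    rewrite [X in _ + _ * X]big1 => [|t _]; last by rewrite v0 // (negPf nik).
    by move/eqP; rewrite mulr0 addr0 mulf_eq0 (negPf xi_neq0) => /eqP.
  have [<-|j_l] := eqVneq j l.
    rewrite big1 // => k _; apply: v0; apply/negP => /and3P[_ jk kj].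
    by have := edge_asym kj; rewrite jk.
  have := dv0 i j l (edge_neq ij) j_l.
  rewrite (negPf njl) andbF => /(_ isT).
  rewrite [X in _ * X + _]big1 => [|t _]; last by rewrite v0 // (negPf njl) !andbF.
  by move/eqP; rewrite mulr0 add0r mulf_eq0 expf_eq0 (negPf xi_neq0) => /eqP.
have v0 := coef_non_allowed v_allowed.
apply/andP; split; apply/in_allowed_space => // q.
rewrite (tuple3E q) allowed3E.
move: (tnth q 0) (tnth q 1) (tnth q 2) => x y z {q}.
apply: contraNT => nxyz; apply/eqP.
have [xyz_reg|xyz_nreg] := boolP (regular [tuple x; y; z]); last first.
  rewrite /boundary sum_ffunE big1 // => p _.
  rewrite ffunE /boundary_elem sum_ffunE big1 ?scaler0 // => j j_reg.
  rewrite !ffunE; case: eqVneq => [e|_]; last by rewrite scaler0.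
  by case/negP: xyz_nreg; rewrite e.
(* Each sum is either a cancellation hypothesis or has no allowed term. *)
have [sumj0 sumk0] : \sum_t v [tuple x; t; y; z] = 0 /\
    \sum_t v [tuple x; y; t; z] = 0.
  have [yz|nyz] := boolP (edge y z).
    rewrite yz andbT in nxyz; split; first exact: sumj.
    by rewrite big1 // => t _; rewrite v0 // (negPf nxyz).
  split; first by rewrite big1 // => t _; rewrite v0 // (negPf nyz) !andbF.
  have [xy|nxy] := boolP (edge x y); first exact: sumk.
  by rewrite big1 // => t _; rewrite v0 // (negPf nxy).
by rewrite (boundary_allowedE v_allowed) // sumj0 sumk0 !mulr0 addr0.
Qed.

(** * Types of 2-paths and the nine possible patterns *)

Lemma type_non_admissible (x y z : V) :
  ~~ (edge x y && edge y z) -> type_of_path x y z = N_w.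
Proof. by rewrite /type_of_path allowed3E => ->. Qed.

Lemma type_admissible (x y z : V) :
  edge x y -> edge y z -> type_of_path x y z <> N_w.
Proof. by rewrite /type_of_path allowed3E => -> -> /=; case: ifP => // _; case: ifP. Qed.

Lemma type_triangle (x y z : V) :
  edge x y -> edge y z -> edge x z -> type_of_path x y z = T.
Proof. by rewrite /type_of_path allowed3E => -> -> ->. Qed.

Lemma type_square (y' x y z : V) :
    edge x y -> edge y z -> ~~ edge x z -> y' != y -> edge x y' -> edge y' z ->
  type_of_path x y z = S.
Proof.
rewrite /type_of_path allowed3E => -> -> /negPf-> y'_y xy' y'z /=.
by case: existsP => // -[]; exists y'; rewrite y'_y allowed3E xy' y'z.
Qed.

Lemma type_only_admissible (x y z : V) :
    edge x y -> edge y z -> ~~ edge x z ->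
    (forall y', edge x y' -> edge y' z -> y' = y) ->
  type_of_path x y z = W.
Proof.
rewrite /type_of_path allowed3E => -> -> /negPf-> y_uniq /=.
case: existsP => // -[y' /andP[/eqP y'_y]].
by rewrite allowed3E => /andP[xy' y'z]; case: y'_y; apply: y_uniq.
Qed.

Lemma image_typeE (i j k l : V) :
  image_type [tuple i; j; k; l] =
    (type_of_path j k l, type_of_path i k l, type_of_path i j l, type_of_path i j k).
Proof. by []. Qed.

Lemma Omega_image_type (xi : K) (v : chain 3) (p : epath G 3) :
    xi != 0 -> Omega xi v -> v p != 0 ->
  ([set (T, T, T, T); (T, S, S, T)] `|` family_L) (image_type p).
Proof.
move=> xi_neq0 /(Omega3P v xi_neq0)[v_allowed sumj sumk].
rewrite (tuple4E p) image_typeE.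
move: (tnth p 0) (tnth p 1) (tnth p 2) (tnth p 3) => i j k l {p} vp_neq0.
have := v_allowed _ vp_neq0; rewrite allowed4E => /and3P[ij jk kl].
have square_ijk : ~~ edge i k -> type_of_path i j k = S.
  move=> nik; have /existsP[j' /andP[j'_j vj'_neq0]] :
      [exists j', (j' != j) && (v [tuple i; j'; k; l] != 0)].
    apply: contraNT vp_neq0 => /existsPn vj'0; have := sumj i k l kl nik.
    rewrite (bigD1 j) //= big1 ?addr0 => [->//|j' j'_j].
    by have := vj'0 j'; rewrite j'_j negbK => /eqP.
  have := v_allowed _ vj'_neq0; rewrite allowed4E => /and3P[ij' j'k _].
  exact: type_square j'_j ij' j'k.
have square_jkl : ~~ edge j l -> type_of_path j k l = S.
  move=> njl; have /existsP[k' /andP[k'_k vk'_neq0]] :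
      [exists k', (k' != k) && (v [tuple i; j; k'; l] != 0)].
    apply: contraNT vp_neq0 => /existsPn vk'0; have := sumk i j l ij njl.
    rewrite (bigD1 k) //= big1 ?addr0 => [->//|k' k'_k].
    by have := vk'0 k'; rewrite k'_k negbK => /eqP.
  have := v_allowed _ vk'_neq0; rewrite allowed4E => /and3P[_ jk' k'l].
  exact: type_square k'_k jk' k'l.
have [ik|nik] := boolP (edge i k); have [jl|njl] := boolP (edge j l).
- rewrite (type_triangle jk kl jl) (type_triangle ij jk ik).
  have [il|nil] := boolP (edge i l).
    by rewrite (type_triangle ik kl il) (type_triangle ij jl il); left; left.
  (* The routes i -> j -> l and i -> k -> l make each other squares. *)
  have j_k := edge_neq jk; have k_j : k != j by rewrite eq_sym.
  rewrite (type_square ik kl nil j_k ij jl) (type_square ij jl nil k_j ik kl).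
  by left; right.
- rewrite (square_jkl njl) (type_triangle ij jk ik).
  rewrite (@type_non_admissible i j l) ?(negPf njl) ?andbF //; right.
  have := type_admissible ik kl; rewrite /family_L /=.
  by case: (type_of_path i k l) => //; tauto.
- rewrite (square_ijk nik) (type_triangle jk kl jl).
  rewrite (@type_non_admissible i k l) ?(negPf nik) //; right.
  have := type_admissible ij jl; rewrite /family_L /=.
  by case: (type_of_path i j l) => //; tauto.
- rewrite (square_jkl njl) (square_ijk nik).
  rewrite !type_non_admissible ?(negPf nik) ?(negPf njl) ?andbF //.
  by right; right.
Qed.

(** * Minimal clusters on one path and on a 4-cycle *)

Lemma minimal_of_scale (xi : K) (w : chain 3) :
    Omega xi w ->
    (forall u, Omega xi u -> components u \subset components w ->
      exists c : K, u = c *: w) ->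
  minimal xi w.
Proof.
move=> w_Omega scale_w; split=> // -[u [u_neq0 /properP[u_sub_w [p pw pu]] u_Omega]].
have [c u_cw] := scale_w u u_Omega u_sub_w.
move: pw pu; rewrite u_cw !inE !ffunE mulf_eq0 negb_or => wp_neq0.
rewrite wp_neq0 andbT negbK => /eqP c_eq0.
by rewrite u_cw c_eq0 scale0r eqxx in u_neq0.
Qed.

Lemma boolr_neq0 (b : bool) : (b%:R != 0 :> K) = b.
Proof. by case: b; rewrite ?oner_eq0 ?eqxx. Qed.

(** With i -> k and j -> l present, no cancellation constrains the path, so it forms a minimal
    element alone. *)
Lemma triangle_component (xi : K) (i j k l : V) : xi != 0 ->
    edge i j -> edge j k -> edge k l -> edge i k -> edge j l ->
  cluster_components xi [tuple i; j; k; l].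
Proof.
move=> xi_neq0 ij jk kl ik jl; set p := [tuple i; j; k; l].
have elem_supp q : (q \in components (elem K p)) = (q == p).
  by rewrite inE ffunE boolr_neq0.
exists (elem K p); split; last by rewrite elem_supp.
  apply: minimal_of_scale => [|u u_Omega u_sub_p].
    apply/Omega3P => //; split=> [q|i' k' l' _ ni'k'|i' j' l' _ nj'l'].
    - rewrite ffunE boolr_neq0 => /eqP->.
      by rewrite allowed4E ij jk kl.
    - apply: big1 => j' _; rewrite ffunE; case: eqP => // /(congr1 val)[ii' _ kk' _].
      by rewrite ii' kk' ik in ni'k'.
    - apply: big1 => k' _; rewrite ffunE; case: eqP => // /(congr1 val)[_ jj' _ ll'].
      by rewrite jj' ll' jl in nj'l'.
  exists (u p); apply/ffunP => q; rewrite !ffunE.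
  have [->|q_p] := eqVneq q p; first by rewrite [_ *: _]mulr1.
  rewrite scaler0; apply/eqP; apply: contraNT q_p => uq_neq0.
  by rewrite -elem_supp (fintype.subsetP u_sub_p) ?inE.
by exists i, l => q; rewrite elem_supp => /eqP->.
Qed.

Lemma sum_two (x y : V) (f : V -> K) : x != y ->
    (forall z, z != x -> z != y -> f z = 0) ->
  \sum_z f z = f x + f y.
Proof.
move=> x_y f0; rewrite (bigD1 x) //= (bigD1 y) /=; last by rewrite eq_sym.
by rewrite big1 ?addr0 // => z /andP[]; apply: f0.
Qed.

(** A product of two dipoles puts alternating signs on the edges of a 4-cycle, with zero sum at each
    of its vertices. *)
Definition dipole (x y z : V) : K := (z == x)%:R - (z == y)%:R.

Lemma sum_dipole (x y : V) : \sum_z dipole x y z = 0.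
Proof.
rewrite sumrB; apply/eqP; rewrite subr_eq0; apply/eqP.
have sum1 t : \sum_z (z == t)%:R = 1 :> K.
  by rewrite (bigD1 t) //= eqxx big1 ?addr0 // => z /negPf->.
by rewrite !sum1.
Qed.

Lemma dipole_supp (x y z : V) : dipole x y z != 0 -> z = x \/ z = y.
Proof.
rewrite /dipole; case: (eqVneq z x); first by left.
by case: (eqVneq z y); [right | rewrite subrr eqxx].
Qed.

(* The cycle j1 k1 j2 k2 contains at most one vertex at which the             *)
(* coefficients of its edges are not forced to cancel; the other three        *)
(* cancellations determine a chain supported on it up to a scalar.            *)
Lemma cycle_component (xi : K) (a j1 j2 k1 k2 b : V) : xi != 0 ->
    j1 != j2 -> k1 != k2 ->
    edge a j1 -> edge a j2 -> edge k1 b -> edge k2 b ->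
    edge j1 k1 -> edge j1 k2 -> edge j2 k1 -> edge j2 k2 ->
    ~~ edge a k2 -> ~~ edge j2 b -> ~~ (edge a k1 && edge j1 b) ->
  cluster_components xi [tuple a; j1; k1; b].
Proof.
move=> xi_neq0 j1_j2 k1_k2 aj1 aj2 k1b k2b j1k1 j1k2 j2k1 j2k2 nak2 nj2b nfree.
pose w : chain 3 := [ffun p : epath G 3 =>
  ((tnth p 0 == a) && (tnth p 3 == b))%:R *
  (dipole j1 j2 (tnth p 1) * dipole k1 k2 (tnth p 2)) : K].
have wE i j k l : w [tuple i; j; k; l] =
    ((i == a) && (l == b))%:R * (dipole j1 j2 j * dipole k1 k2 k) :> K.
  by rewrite ffunE.
have w_supp i j k l : w [tuple i; j; k; l] != 0 ->
    [/\ i = a, j = j1 \/ j = j2, k = k1 \/ k = k2 & l = b].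
  rewrite wE !(mulf_eq0, negb_or) boolr_neq0.
  by case/and3P=> /andP[/eqP-> /eqP->] /dipole_supp ? /dipole_supp ?.
have dipole1 x y : x != y -> dipole x y x = 1.
  by move=> /negPf x_y; rewrite /dipole eqxx x_y subr0.
have dipole2 x y : x != y -> dipole x y y = -1.
  by move=> /negPf x_y; rewrite /dipole eqxx eq_sym x_y sub0r.
exists w; split.
- apply: minimal_of_scale => [|u /(Omega3P u xi_neq0)[_ sumj sumk] u_sub_w].
    apply/Omega3P => //; split=> [p|i k l _ _|i j l _ _].
    + rewrite (tuple4E p) => /w_supp[-> jj kk ->].
      by rewrite allowed4E; case: jj kk => -> [] ->; apply/and3P.
    + by under eq_bigr do rewrite wE mulrCA; rewrite -big_distrl /= sum_dipole mul0r.
    + by under eq_bigr do rewrite wE mulrA; rewrite -big_distrr /= sum_dipole mulr0.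
  have u_w p : u p != 0 -> w p != 0.
    by have /fintype.subsetP/(_ p) := u_sub_w; rewrite !inE.
  have u_supp i j k l : u [tuple i; j; k; l] != 0 ->
      [/\ i = a, j = j1 \/ j = j2, k = k1 \/ k = k2 & l = b].
    by move=> up_neq0; apply/w_supp/u_w.
  have u_sumj k : ~~ edge a k -> edge k b ->
      u [tuple a; j1; k; b] + u [tuple a; j2; k; b] = 0 :> K.
    move=> nak kb; rewrite -(sumj a k b kb nak); apply/esym/sum_two => // j.
    move=> j_j1 j_j2; apply: contraNeq j_j1 => /u_supp[_ [->|j_eq] _ _] //.
    by rewrite j_eq eqxx in j_j2.
  have u_sumk j : edge a j -> ~~ edge j b ->
      u [tuple a; j; k1; b] + u [tuple a; j; k2; b] = 0 :> K.
    move=> aj njb; rewrite -(sumk a j b aj njb); apply/esym/sum_two => // k.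
    move=> k_k1 k_k2; apply: contraNeq k_k1 => /u_supp[_ _ [->|k_eq] _] //.
    by rewrite k_eq eqxx in k_k2.
  have u22 := u_sumj k2 nak2 k2b; have u22' := u_sumk j2 aj2 nj2b.
  exists (u [tuple a; j1; k1; b]).
  have [u12 u21] :
      u [tuple a; j1; k2; b] = - u [tuple a; j1; k1; b] :> K /\
      u [tuple a; j2; k1; b] = - u [tuple a; j1; k1; b] :> K.
    (* The cancellations at k2 and j2 share the coefficient of j2 -> k2. *)
    have u12_u21 : u [tuple a; j1; k2; b] = u [tuple a; j2; k1; b].
      by apply: (addIr (u [tuple a; j2; k2; b])); rewrite u22 u22'.
    rewrite u12_u21; suff u21 : u [tuple a; j1; k1; b] + u [tuple a; j2; k1; b] = 0.
      by have := addr0_eq u21 => ->.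
    (* The third cancellation is at k1 or, if k1 is free, at j1. *)
    have [ak1|nak1] := boolP (edge a k1); last exact: u_sumj.
    by rewrite -u12_u21; apply: u_sumk => //; move: nfree; rewrite ak1.
  have u22E : u [tuple a; j2; k2; b] = u [tuple a; j1; k1; b] :> K.
    by rewrite -(addr0_eq u22') u21 opprK.
  apply/ffunP => p; rewrite ffunE (tuple4E p).
  move: (tnth p 0) (tnth p 1) (tnth p 2) (tnth p 3) => i j k l {p}.
  have [w0|/w_supp[-> jj kk ->]] := eqVneq (w [tuple i; j; k; l]) 0.
    by rewrite w0 scaler0; apply: contra_eq w0; apply: u_w.
  have wE' j' k' : w [tuple a; j'; k'; b] = dipole j1 j2 j' * dipole k1 k2 k' :> K.
    by rewrite wE !eqxx mul1r.
  rewrite wE'; case: jj kk => -> [] ->; rewrite ?dipole1 ?dipole2 //.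
  + by rewrite mulr1 [_ *: _]mulr1.
  + by rewrite mul1r [_ *: _]mulrN1.
  + by rewrite mulr1 [_ *: _]mulrN1.
  + by rewrite mulrNN mulr1 [_ *: _]mulr1.
- exists a, b => p; rewrite inE (tuple4E p).
  by move/w_supp => [-> _ _ ->].
- by rewrite inE wE !eqxx mul1r dipole1 // dipole1 // mulr1 oner_eq0.
Qed.

End Omega3.

(** * Digraphs realising the patterns *)

(* The paths 0 -> {1, 2} -> {3, 4} -> 6, where 3 is free if f3 and 1 is free  *)
(* if f1; the edge 0 -> 6 (if f06) and the vertex 5 (if f5) tune the type of  *)
(* the 2-paths from 0 to 6.                                                   *)
Definition cycle_edges (f3 f1 f06 f5 : bool) : seq (nat * nat) :=
  [:: (0, 1); (0, 2); (1, 3); (1, 4); (2, 3); (2, 4); (3, 6); (4, 6)]%N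
  ++ nseq f3 (0, 3)%N ++ nseq f1 (1, 6)%N ++ nseq f06 (0, 6)%N
  ++ (if f5 then [:: (0, 5); (5, 6)] else [::])%N.

Section CycleDigraph.
Variables f3 f1 f06 f5 : bool.

Definition cycle_edge : rel 'I_7 :=
  fun x y => (val x, val y) \in cycle_edges f3 f1 f06 f5.

(** Increasing labels rule out loops and opposite edges at once. *)
Lemma cycle_edge_lt x y : cycle_edge x y -> (x < y)%N.
Proof.
have /allP/(_ (val x, val y)) : all (fun e => e.1 < e.2)%N (cycle_edges f3 f1 f06 f5).
  by case: f3; case: f1; case: f06; case: f5.
exact.
Qed.

Lemma cycle_edge_no_loop x : ~~ cycle_edge x x.
Proof. by apply/negP => /cycle_edge_lt; rewrite ltnn. Qed.

Lemma cycle_edge_no_multi x y : ~~ (cycle_edge x y && cycle_edge y x).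
Proof.
apply/negP => /andP[/cycle_edge_lt xy /cycle_edge_lt /(ltn_trans xy)].
by rewrite ltnn.
Qed.

Definition cycle_digraph : simpleDigraph :=
  @SimpleDigraph 'I_7 cycle_edge cycle_edge_no_loop cycle_edge_no_multi.

End CycleDigraph.

Section ImageTypes.
Variables (K : fieldType) (xi : K).
Hypothesis xi_neq0 : xi != 0.

Local Notation v n := (Ordinal (isT : (n < 7)%N)).

Lemma triangle_image_type (f06 : bool) :
  image_types xi (@image_type (cycle_digraph true true f06 false)
                    [tuple v 0; v 1; v 3; v 6]).
Proof.
set D := cycle_digraph _ _ _ _; exists D, [tuple v 0; v 1; v 3; v 6].
by split; first exact: triangle_component.
Qed.

Lemma cycle_image_type (f3 f1 f06 f5 : bool) : ~~ (f3 && f1) ->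
  image_types xi (@image_type (cycle_digraph f3 f1 f06 f5)
                    [tuple v 0; v 1; v 3; v 6]).
Proof.
set D := cycle_digraph _ _ _ _ => nfree.
exists D, [tuple v 0; v 1; v 3; v 6]; split=> //.
apply: (@cycle_component _ D xi (v 0) (v 1) (v 2) (v 3) (v 4) (v 6)) => //;
  by move: nfree; rewrite {}/D; case: f3; case: f1; case: f06; case: f5.
Qed.

Lemma image_types_TTTT : image_types xi (T, T, T, T).
Proof.
(* Types T and N_w are decided by computation; here and below only the types  *)
(* S and W, which involve an existential over the vertices, remain.           *)
have := triangle_image_type true; set D := cycle_digraph _ _ _ _.
rewrite (image_typeE (G := D)); congr (image_types xi (_, _, _, _)).
Qed.

Lemma image_types_TSST : image_types xi (T, S, S, T).
Proof.
have := triangle_image_type false; set D := cycle_digraph _ _ _ _.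
rewrite (image_typeE (G := D)); congr (image_types xi (_, _, _, _)).
- exact: (@type_square D (v 1)).
- exact: (@type_square D (v 3)).
Qed.

Lemma image_types_STNT : image_types xi (S, T, N_w, T).
Proof.
have := @cycle_image_type true false true false isT.
set D := cycle_digraph _ _ _ _.
rewrite (image_typeE (G := D)); congr (image_types xi (_, _, _, _)).
- exact: (@type_square D (v 4)).
Qed.

Lemma image_types_SSNT : image_types xi (S, S, N_w, T).
Proof.
have := @cycle_image_type true false false true isT.
set D := cycle_digraph _ _ _ _.
rewrite (image_typeE (G := D)); congr (image_types xi (_, _, _, _)).
- exact: (@type_square D (v 4)).
- exact: (@type_square D (v 5)).
Qed.

Lemma image_types_SWNT : image_types xi (S, W, N_w, T).
Proof.
have := @cycle_image_type true false false false isT.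
set D := cycle_digraph _ _ _ _.
rewrite (image_typeE (G := D)); congr (image_types xi (_, _, _, _)).
- exact: (@type_square D (v 4)).
(* Of the vertices 1, 2, 3 reached from 0, only 3 has an edge to 6. *)
- apply: type_only_admissible => //.
  by case=> [[|[|[|[|[|[|[|]]]]]]] ?] // _ _; apply: val_inj.
Qed.

Lemma image_types_TNTS : image_types xi (T, N_w, T, S).
Proof.
have := @cycle_image_type false true true false isT.
set D := cycle_digraph _ _ _ _.
rewrite (image_typeE (G := D)); congr (image_types xi (_, _, _, _)).
- exact: (@type_square D (v 2)).
Qed.

Lemma image_types_TNSS : image_types xi (T, N_w, S, S).
Proof.
have := @cycle_image_type false true false true isT.
set D := cycle_digraph _ _ _ _.
rewrite (image_typeE (G := D)); congr (image_types xi (_, _, _, _)).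
- exact: (@type_square D (v 5)).
- exact: (@type_square D (v 2)).
Qed.

Lemma image_types_TNWS : image_types xi (T, N_w, W, S).
Proof.
have := @cycle_image_type false true false false isT.
set D := cycle_digraph _ _ _ _.
rewrite (image_typeE (G := D)); congr (image_types xi (_, _, _, _)).
(* Of the vertices 1, 2 reached from 0, only 1 has an edge to 6. *)
- apply: type_only_admissible => //.
  by case=> [[|[|[|[|[|[|[|]]]]]]] ?] // _ _; apply: val_inj.
- exact: (@type_square D (v 2)).
Qed.

Lemma image_types_SNNS : image_types xi (S, N_w, N_w, S).
Proof.
have := @cycle_image_type false false false false isT.
set D := cycle_digraph _ _ _ _.
rewrite (image_typeE (G := D)); congr (image_types xi (_, _, _, _)).
- exact: (@type_square D (v 4)).
- exact: (@type_square D (v 2)).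
Qed.

Lemma image_typesE :
  image_types xi = [set (T, T, T, T); (T, S, S, T)] `|` family_L.
Proof.
apply/seteqP; split=> [t [G [p [[w [[w_Omega _] _ wp_neq0]] <-]]]|t].
  move: wp_neq0; rewrite inE => wp_neq0. exact: (Omega_image_type xi_neq0 w_Omega wp_neq0).
case; first by case=> ->; [apply: image_types_TTTT | apply: image_types_TSST].
rewrite /family_L /= => tL.
case: tL => [[[[[[|]|]|]|]|]|] ->.
- exact: image_types_STNT.
- exact: image_types_SSNT.
- exact: image_types_SWNT.
- exact: image_types_TNTS.
- exact: image_types_TNSS.
- exact: image_types_TNWS.
- exact: image_types_SNNS.
Qed.

End ImageTypes.

(** The patterns are listed without repetition, so indexing the list is injective on [I_9]. *)
Lemma card_nine_patterns :
  [set (T, T, T, T); (T, S, S, T)] `|` family_L #= `I_9.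
Proof.
pose pats : seq pattern := [:: (T, T, T, T); (T, S, S, T); (S, T, N_w, T);
  (S, S, N_w, T); (S, W, N_w, T); (T, N_w, T, S); (T, N_w, S, S);
  (T, N_w, W, S); (S, N_w, N_w, S)].
have -> : [set (T, T, T, T); (T, S, S, T)] `|` family_L =
    nth (T, T, T, T) pats @` `I_9.
  apply/seteqP; split=> [t tP|t [n n_lt9 <-]].
    suff [n [? <-]] : exists n, (n < 9)%N /\ nth (T, T, T, T) pats n = t by exists n.
    case: tP => [[|]|[[[[[[|]|]|]|]|]|]] ->.
    - by exists 0%N.
    - by exists 1%N.
    - by exists 2%N.
    - by exists 3%N.
    - by exists 4%N.
    - by exists 5%N.
    - by exists 6%N.
    - by exists 7%N.
    - by exists 8%N.
  rewrite /family_L /=.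
  by do 9!(case: n n_lt9 => [_|n n_lt9] /=; first tauto).
apply: inj_card_eq => m n; rewrite !inE /=.
by do 9?[case: m => [|m]] => //; do 9?[case: n => [|n]].
Qed.

Theorem theorem3p6 (R : realType) (N : nat) (xi : R[i])
    (N_ge2 : (2 <= N)%N) (xi_prim : N.-primitive_root xi) :
  image_types xi = [set (T, T, T, T); (T, S, S, T)] `|` family_L /\
  image_types xi #= `I_9.
Proof.
have xi_neq0 : xi != 0 by rewrite (prim_root_eq0 xi_prim) -lt0n ltnW.
by rewrite (image_typesE xi_neq0); split=> //; apply: card_nine_patterns.
Qed.
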